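(* Let $\Sigma\subset N$ be a nonempty fan. The fan $\Sigma$ may be recovered from the irrational toric variety $Y_\Sigma$ using limits under translation by one-parameter subgroups $\gamma_{sv}$ of elements $y$ in the dense orbit. Precisely, let $y$ be any point of the dense $T_N$-orbit of $Y_\Sigma$, let $|\Sigma|$ be the set of $v\in N$ such that $\gamma_{sv}.y$ has a limit in $Y_\Sigma$ as $s\to\infty$, and for $v,w\in|\Sigma|$ declare $v\sim w$ if and only if $\lim_{s\to\infty}\gamma_{sv}.y=\lim_{s\to\infty}\gamma_{sw}.y$. Then $|\Sigma|$ is the support $\bigcup_{\sigma\in\Sigma}\sigma$ of $\Sigma$, the equivalence classes of $\sim$ are the relative interiors of the cones of $\Sigma$, and each cone $\sigma\in\Sigma$ is the closure of the set of $v\in|\Sigma|$ such that $\lim_{s\to\infty}\gamma_{sv}.y\in U_\sigma$.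
   Context: $M$ and $N$ are dual finite-dimensional real vector spaces with pairing $u\cdot v$; $\mathbb{R}_>$, $\mathbb{R}_\geq$ are the positive and nonnegative reals. A polyhedral cone is a set $\mathbb{R}_\geq v_1+\dots+\mathbb{R}_\geq v_k$; the dual of a cone $\sigma\subset N$ is $\sigma^\vee=\{u\in M\mid u\cdot v\geq0\ \forall v\in\sigma\}$; $\sigma^\perp\subset M$ is its annihilator. A face of $\sigma$ is a set $\{v\in\sigma\mid u\cdot v=0\}$ with $u\in\sigma^\vee$, and similarly for cones in $M$; the relative interior of $\sigma$ is the complement in $\sigma$ of its proper faces. A fan $\Sigma\subset N$ is a finite collection of polyhedral cones in $N$ closed under taking faces such that any two of its cones meet in a common face. $T_N$ is $N$ as a multiplicative group, identified with the group of continuous homomorphisms $M\to\mathbb{R}_>$ by $v\mapsto\gamma_v$, $\gamma_v(u)=\exp(-u\cdot v)$; for $t=\gamma_v$ write $t^u=\gamma_v(u)$. For a polyhedral cone $C\subset M$, $\mathrm{Hom}_c(C,\mathbb{R}_\geq)$ is the set of monoid homomorphisms $\varphi\colon(C,+)\to(\mathbb{R}_\geq,\times)$ (so $\varphi(0)=1$) that are continuous on the relative interior of each face of $C$, with the weakest topology making all evaluations at points of $C$ continuous. $T_N$ acts by $(t.\varphi)(u)=t^u\varphi(u)$. For $\sigma\in\Sigma$ put $V_\sigma=\mathrm{Hom}_c(\sigma^\vee,\mathbb{R}_\geq)$. For $\tau$ a face of $\sigma$, restriction from $\tau^\vee$ to $\sigma^\vee$ gives a $T_N$-equivariant inclusion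 $V_\tau\hookrightarrow V_\sigma$. The irrational toric variety $Y_\Sigma=\bigcup_{\sigma\in\Sigma}V_\sigma$ is obtained by gluing the $V_\sigma$ along these inclusions, with its $T_N$-action. For $\sigma\in\Sigma$, $x_\sigma\in V_\sigma$ is the homomorphism with value $1$ on $\sigma^\perp$ and $0$ on $\sigma^\vee\smallsetminus\sigma^\perp$, and $U_\sigma=T_N.x_\sigma$. The dense orbit of $Y_\Sigma$ is $U_L$, where $L$ is the minimal cone of $\Sigma$ (the common lineality space of its cones). *)

(* Defs.v *)
From HB Require Import structures.
From mathcomp Require Import all_boot all_order all_algebra.
From mathcomp Require Import generic_quotient sesquilinear.
From mathcomp Require Import all_classical all_reals all_analysis.
From Stdlib Require Import Relation_Operators.

Set Implicit Arguments.
Unset Strict Implicit.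
Unset Printing Implicit Defensive.
Import Order.TTheory GRing.Theory Num.Theory.
Import numFieldTopology.Exports numFieldNormedType.Exports.
Local Open Scope classical_set_scope.
Local Open Scope ring_scope.
Local Open Scope quotient_scope.

(* The Euclidean topology of a finite-dimensional real vector space, carried
   over from R^n by the coordinates in a basis. *)
Definition coordinates (R : realType) (V : vectType R) (v : V) :
    'rV[R]_(\dim {:V}) :=
  \row_i coord (vbasis {:V}) i v.

Definition euclidean (R : realType) (V : vectType R) : Type :=
  initial_topology (@coordinates R V).
HB.instance Definition _ (R : realType) (V : vectType R) :=
  Topological.copy (euclidean V) (initial_topology (@coordinates R V)).

Notation pairing M N := {bilinear M -> N -> _ | *%R & *%R}.

Definition perfect (R : realType) (M N : vectType R) (p : M -> N -> R) :=
  (forall u, (forall v, p u v = 0) -> u = 0) /\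
  (forall v, (forall u, p u v = 0) -> v = 0).

Section Cones.
Variable R : realType.

Definition polyhedral_cone (V : lmodType R) (C : set V) :=
  exists (k : nat) (g : 'I_k -> V),
    C = [set \sum_i c i *: g i | c in [set c : 'I_k -> R | forall i, 0 <= c i]].

(* For a pairing b : U -> V -> R, the notions below concern cones in V.  They
   are used both for cones in N, with b u v = u . v, and for cones in M, with
   the two arguments exchanged. *)
Variables (U V : lmodType R) (b : U -> V -> R).

Definition dual_cone (C : set V) : set U :=
  [set u | forall v, C v -> 0 <= b u v].

Definition annihilator (C : set V) : set U :=
  [set u | forall v, C v -> b u v = 0].

Definition face (F C : set V) :=
  exists2 u, dual_cone C u & F = [set v | C v /\ b u v = 0].

Definition relint (C : set V) : set V :=
  [set v | C v /\ forall F, face F C -> F <> C -> ~ F v].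

End Cones.

Record fan (R : realType) (M N : vectType R) (p : M -> N -> R) := Fan {
  cones :> set (set N);
  fan_finite : finite_set cones;
  fan_polyhedral : forall s, cones s -> polyhedral_cone s;
  fan_face : forall s t, cones s -> face p t s -> cones t;
  fan_meet : forall s t, cones s -> cones t ->
    face p (s `&` t) s /\ face p (s `&` t) t }.

Section Homc.
Variables (R : realType) (M N : vectType R) (p : pairing M N).

(* Hom_c(C, R_>=): functions on the points of C, with the topology of
   pointwise convergence. *)
Definition is_homc (C : set (euclidean M)) : set {ptws C -> R} :=
  [set phi |
    [/\ forall a, 0 <= phi a,
        forall a, set_val a = 0 :> M -> phi a = 1,
        forall a a' c : C, set_val c = (set_val a : M) + set_val a' ->
          phi c = phi a * phi a'
      & forall F : set M, face (fun v u => p u v) F C ->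
          {within [set a : C | relint (fun v u => p u v) F (set_val a)],
            continuous (phi : C -> R)}]].

Definition homc (C : set (euclidean M)) : Type := set_type (@is_homc C).
HB.instance Definition _ C := Topological.copy (homc C) (set_type (@is_homc C)).

Definition homc_fun (C : set (euclidean M)) (phi : homc C) : C -> R := \val phi.

(* T_N is the group N itself: v stands for gamma_v, and t^u is gamma v u. *)
Definition gamma (v : N) (u : M) : R := expR (- p u v).

Lemma pairing_continuous v : continuous (fun u : euclidean M => p u v).
Proof.
pose f (x : 'rV[R]_(\dim {:M})) := \sum_i x 0 i * p (vbasis {:M})`_i v.
have -> : (fun u : euclidean M => p u v) = f \o @coordinates R M.
  apply/funext => u; rewrite /f /= [in LHS](coord_vbasis (memvf (u : M))).
  by rewrite linear_sumlz; apply: eq_bigr => i _; rewrite linearZl_LR /= mxE.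
move=> u; apply: continuous_comp; first exact: initial_continuous.
move: (coordinates u) => x.
suff : f y @[y --> x] --> f x by [].
rewrite /f; elim: (index_enum _) => [|i r IHr].
  rewrite big_nil; under eq_fun do rewrite big_nil.
  exact: (@cst_continuous 'rV[R]_(\dim {:M}) R 0 x).
rewrite big_cons; under eq_fun do rewrite big_cons.
apply: cvgD IHr.
apply: cvgM; [exact: coord_continuous|exact: cvg_cst].
Qed.

Lemma homc_act_subproof (C : set (euclidean M)) (v : N) (phi : homc C) :
  is_homc (fun a => gamma v (set_val a) * homc_fun phi a : R).
Proof.
have [phi_ge0 phi0 phiD phi_cont] := set_mem (valP phi).
split => /= [a|a a0|a a' c cE|F FC].
- by rewrite mulr_ge0 ?expR_ge0 ?phi_ge0.
- by rewrite /homc_fun phi0// /gamma a0 linear0l oppr0 expR0 mulr1.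
- rewrite /homc_fun (phiD _ _ _ cE) /gamma cE linearDl opprD expRD.
  by rewrite mulrACA.
- move=> a; apply: cvgM; last exact: phi_cont.
  apply: (@continuous_subspaceT _ _ _ (fun a : C => gamma v (set_val a))) => {}a.
  have ci : {for a, continuous (set_val : C -> euclidean M)}.
    exact: initial_continuous.
  have ce (r : R) : {for r, continuous (fun x : R => expR (- x))}.
    by apply: continuous_comp; [exact: opp_continuous|exact: continuous_expR].
  exact: (continuous_comp (continuous_comp ci (@pairing_continuous v _)) (ce _)).
Qed.

Definition homc_act (C : set (euclidean M)) (v : N) (phi : homc C) : homc C :=
  exist (fun f => f \in @is_homc C) _ (mem_set (homc_act_subproof v phi)).

Lemma homc_pt_subproof (s : set N) : polyhedral_cone s ->
  @is_homc (dual_cone p s)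
    (fun a => `[< annihilator p s (set_val a) >]%:R : R).
Proof.
move=> [k [g sE]].
have gs i : s (g i).
  rewrite sE; exists (fun j => (j == i)%:R); first by move=> j; rewrite ler0n.
  rewrite (bigD1 i)//= eqxx scale1r big1 ?addr0// => j /negbTE ->.
  by rewrite scale0r.
have annP u : (forall i, p u (g i) = 0) -> annihilator p s u.
  move=> ug v; rewrite sE => -[c _ <-].
  by rewrite linear_sumr big1// => i _; rewrite linearZr_LR ug /= mulr0.
split => [a|a a0|a a' c cE|F FC].
- exact: ler0n.
- by rewrite asboolT// => v _; rewrite a0 linear0l.
- rewrite -natrM mulnb; congr (nat_of_bool _)%:R.
  apply/asboolP/andP => [c0|[/asboolP a0 /asboolP a0']]; last first.
    by move=> v sv; rewrite cE linearDl a0// a0'// addr0.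
  have le0 (b : dual_cone p s) v : s v -> 0 <= p (set_val b) v.
    by move=> sv; exact: (set_mem (valP b)).
  split; apply/asboolP => v sv; have /eqP := c0 v sv;
    by rewrite cE linearDl paddr_eq0 ?le0// => /andP[/eqP + /eqP].
- have [[w [[Fw wmin] w0]]|Nw] := pselect (exists w,
    relint (fun v u => p u v) F w /\ annihilator p s w); last first.
    apply: (@subspace_eq_continuous _ _ _ (cst 0)); last first.
      by apply: continuous_subspaceT; exact: cst_continuous.
    move=> a /set_mem aF; rewrite /from_subspace /= asboolF// => a0.
    by apply: Nw; exists (set_val a).
  apply: (@subspace_eq_continuous _ _ _ (cst (1 : R))); last first.
    by apply: continuous_subspaceT; exact: cst_continuous.
  move=> a /set_mem [Fa _]; rewrite /from_subspace /= asboolT//.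
  have Fs u : F u -> dual_cone p s u by case: FC => v _ -> [].
  pose F' := [set u | F u /\ p u (\sum_i g i) = 0].
  have F'F : face (fun v u => p u v) F' F.
    exists (\sum_i g i) => // u Fu /=; rewrite linear_sumr sumr_ge0// => i _.
    exact: Fs.
  have FF' : F' = F.
    apply: contrapT => NF; apply: (wmin _ F'F NF); split => //.
    by rewrite linear_sumr big1// => i _; exact: w0.
  have [_ /eqP] : F' (set_val a) by rewrite FF'.
  rewrite linear_sumr psumr_eq0; last by move=> i _; exact: Fs.
  move=> /allP a0; apply: annP => i; apply/eqP.
  by apply: a0; rewrite mem_index_enum.
Qed.

Definition homc_pt (s : set N) (sP : polyhedral_cone s) :
    homc (dual_cone p s) :=
  exist (fun f => f \in @is_homc (dual_cone p s)) _
    (mem_set (homc_pt_subproof sP)).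

End Homc.

Section ToricVariety.
Variables (R : realType) (M N : vectType R) (p : pairing M N) (Sigma : fan p).

Definition chart (s : cones Sigma) : Type := homc p (dual_cone p (set_val s)).
HB.instance Definition _ s := Topological.on (chart s).

Definition charts : Type := {s : cones Sigma & chart s}.
HB.instance Definition _ := Topological.on charts.

(* x = (t, phi) is glued to y = (s, psi) when t is a face of s and the
   inclusion of V_t into V_s maps phi to psi, that is, psi is the restriction
   of phi to the dual of s. *)
Definition glued (x y : charts) : Prop :=
  face p (set_val (projT1 x)) (set_val (projT1 y)) /\
  forall (a : dual_cone p (set_val (projT1 x)))
         (b : dual_cone p (set_val (projT1 y))),
    set_val a = set_val b :> M ->
    homc_fun (projT2 y) b = homc_fun (projT2 x) a.

(* The charts are identified by the equivalence relation generated by glued,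
   so that toric_variety is the colimit of the V_s along the inclusions. *)
Definition glue (x y : charts) : bool :=
  `[< clos_refl_sym_trans charts glued x y >].

Lemma glue_refl : reflexive glue.
Proof. by move=> x; apply/asboolP; exact: rst_refl. Qed.

Lemma glue_sym : symmetric glue.
Proof.
by move=> x y; apply/asboolP/asboolP => ?; exact: rst_sym.
Qed.

Lemma glue_trans : transitive glue.
Proof.
by move=> y x z /asboolP xy /asboolP yz; apply/asboolP; exact: rst_trans xy yz.
Qed.

Definition glue_equiv := EquivRel glue glue_refl glue_sym glue_trans.

Definition toric_variety : Type := {eq_quot glue_equiv}.
HB.instance Definition _ :=
  Topological.copy toric_variety (quotient_topology toric_variety).
HB.instance Definition _ := Quotient.on toric_variety.

(* The class of phi in Y_Sigma; the torus action on Y_Sigma is computed on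
   representatives, see of_chart_act. *)
Definition of_chart (s : cones Sigma) (phi : chart s) : toric_variety :=
  \pi_toric_variety (existT chart s phi).

Definition act_charts (v : N) (x : charts) : charts :=
  existT chart (projT1 x) (homc_act v (projT2 x)).

Definition torus_act (v : N) (y : toric_variety) : toric_variety :=
  \pi_toric_variety (act_charts v (repr y)).

Lemma act_charts_glue v x y : glue x y -> glue (act_charts v x) (act_charts v y).
Proof.
move=> /asboolP xy; apply/asboolP.
elim: xy => {x y}[x y [xy xyE]|x|x y _|x y z _ xy _]; last exact: rst_trans.
- apply: rst_step; split => // a b ab.
  rewrite -[LHS]/(gamma p v (set_val b) * homc_fun (projT2 y) b).
  by rewrite (xyE _ _ ab) -ab.
- exact: rst_refl.
- exact: rst_sym.
Qed.

Lemma of_chart_act v s (phi : chart s) :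
  torus_act v (of_chart phi) = of_chart (homc_act v phi).
Proof.
apply/(@eqmodP _ glue_equiv).
apply: (@act_charts_glue v _ (existT chart s phi)).
by apply/(@eqmodP _ glue_equiv); rewrite -[RHS]/(of_chart phi) reprK.
Qed.

Definition distinguished_point (s : cones Sigma) : chart s :=
  homc_pt p (fan_polyhedral (set_mem (valP s))).

Definition torus_orbit (s : cones Sigma) : set toric_variety :=
  [set torus_act v (of_chart (distinguished_point s)) | v in [set: N]].

(* The orbit of the minimal cone L of Sigma. *)
Definition dense_orbit : set toric_variety :=
  [set y | exists2 L : cones Sigma,
    (forall s, cones Sigma s -> set_val L `<=` s) & torus_orbit L y].

Definition tends_to (y : toric_variety) (v : N) (z : toric_variety) : Prop :=
  torus_act (s *: v) y @[s --> +oo] --> z.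

Definition has_limit (y : toric_variety) : set N :=
  [set v | exists z, tends_to y v z].

(* This is the library's lim, except that toric_variety (which is empty for an
   empty fan) is not pointed: the default value is y. *)
Definition limit (y : toric_variety) (v : N) : toric_variety :=
  xget y (tends_to y v).

End ToricVariety.

(* Main.v *)
Require Import Defs.
From mathcomp Require Import all_boot all_order all_algebra.
From mathcomp Require Import generic_quotient sesquilinear.
From mathcomp Require Import ring.
From Stdlib Require Import Relation_Operators.
From mathcomp Require Import all_classical all_reals all_analysis.

Set Implicit Arguments.
Unset Strict Implicit.
Unset Printing Implicit Defensive.
Import Order.TTheory GRing.Theory Num.Theory.
Import numFieldTopology.Exports numFieldNormedType.Exports.
Local Open Scope classical_set_scope.
Local Open Scope ring_scope.
Local Open Scope quotient_scope.

(** Let L be the minimal cone of the fan. Minimality forces the dual of L to be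
its annihilator, so y is the translate by some w of the constant homomorphism
1, and in every chart V_s it reads u |-> exp (- u . w). The point
gamma_(r v) . y then reads u |-> exp (- u . (r v + w)), and everything follows
from the behaviour of this function as r grows.

If v is in the relative interior of s and u in the dual of s, then u . v >= 0,
with equality exactly when u annihilates s. Hence gamma_(r v) . y tends in V_s
to w . x_s (tends_to_orbit_point).

For the converse (tends_to_dense), suppose that gamma_(r v) . y tends to a
point of V_t with representative psi. Instead of proving that V_t is open in
the glued space, or that the space is Hausdorff, one uses the characters chi^u
as rational functions: chi^u is defined at phi in V_s when u = c - b with b, c
in the dual of s and phi b > 0, and has the value phi c / phi b. The domain of
chi^u and its values are compatible with the gluing (character_in_glued), and
chi^u is continuous there (open_character_in). For u in the dual of t this
gives exp (- u . (r v + w)) --> psi u, hence u . v >= 0 for all such u, and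
the bipolar theorem, that is Farkas' lemma, puts v in t. If s is the face of t
whose relative interior contains v, then psi has the same values as w . x_s,
so that the limit is w . x_s; in particular it is unique.

Finally the set of the u such that chi^u is defined at w . x_s is the dual of
s, so these points are distinct for distinct s (orbit_point_inj), and a
polyhedral cone is the closure of its relative interior (closure_relint). *)

(** * Polyhedral cones and duality *)

Section Pairing.
Variables (R : realType) (M N : vectType R) (p : pairing M N).

Lemma pairingZl c u v : p (c *: u) v = c * p u v.
Proof. exact: linearZl_LR. Qed.

Lemma pairingZr c u v : p u (c *: v) = c * p u v.
Proof. exact: linearZr_LR. Qed.

End Pairing.

(** Induction on the number of generators, for the functionals p ^~ (g i) on M.
If v is not nonnegative on the dual of the cone of the last k generators, there
is x in that dual with p x v < 0, and then p x (g ord0) < 0. Projecting N along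
g ord0 onto the hyperplane p x = 0 removes the generator g ord0. *)
Lemma farkas (R : realType) (M N : vectType R) (p : pairing M N)
    (p_perfect : perfect p) (k : nat) (g : 'I_k -> N) (v : N) :
    (forall u, (forall i, 0 <= p u (g i)) -> 0 <= p u v) ->
  exists2 c : 'I_k -> R, forall i, 0 <= c i & v = \sum_i c i *: g i.
Proof.
elim: k g v => [|k IHk] g v gv.
  exists (fun=> 0) => //; rewrite big_ord0; apply: p_perfect.2 => u.
  apply/eqP; rewrite eq_le -oppr_ge0 -linearNl.
  by rewrite !gv// => -[].
have [|] := pselect
    (forall u, (forall i, 0 <= p u (g (lift ord0 i))) -> 0 <= p u v).
  move=> /IHk[c c0 ->].
  exists (fun i => if unlift ord0 i is Some j then c j else 0).
    by move=> i; case: unlift.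
  rewrite big_ord_recl unlift_none scale0r add0r.
  by apply: eq_bigr => i _; rewrite liftK.
move=> /existsNP[x /not_implyP[xg /negP]]; rewrite -ltNge => xv.
have xg0 : p x (g ord0) < 0.
  rewrite ltNge; apply/negP => xg0.
  have : 0 <= p x v by apply: gv => i; case: (unliftP ord0 i) => [j|] ->.
  by rewrite leNgt xv.
pose proj w := w - (p x w / p x (g ord0)) *: g ord0.
have projE u w : p u (proj w) = p (u - (p u (g ord0) / p x (g ord0)) *: x) w.
  rewrite /proj linearBr linearBl pairingZr pairingZl; ring.
have [u gu|c c0 cv] := IHk (fun i => proj (g (lift ord0 i))) (proj v).
  rewrite projE; apply: gv => i.
  case: (unliftP ord0 i) => [j|] ->; first by rewrite -projE.
  by rewrite linearBl pairingZl divfK ?subrr// lt_eqF.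
(* v - proj v and g i - proj (g i) are multiples of g ord0; collecting them gives
   its coefficient, which is nonnegative as p x v < 0 <= p x (g (lift ord0 j)). *)
pose c1 := (p x v - \sum_j c j * p x (g (lift ord0 j))) / p x (g ord0).
exists (fun i => if unlift ord0 i is Some j then c j else c1).
  move=> i; case: unlift => //.
  rewrite nmulr_lge0 ?invr_lt0// subr_le0 (le_trans (ltW xv))//.
  by apply: sumr_ge0 => j _; rewrite mulr_ge0.
rewrite big_ord_recl unlift_none; under eq_bigr do rewrite liftK.
have -> : v = proj v + (p x v / p x (g ord0)) *: g ord0 by rewrite subrK.
rewrite cv /proj addrC; under [in LHS]eq_bigr do rewrite scalerBr scalerA.
rewrite sumrB -scaler_suml addrCA addrC; congr (_ + _).
rewrite -scalerBl; congr (_ *: _); rewrite /c1 mulrBl mulr_suml.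
by under [in RHS]eq_bigr do rewrite -mulrA.
Qed.

Lemma cvg_initial (S : choiceType) (T : topologicalType) (f : S -> T)
    (F : set_system S) (x : S) : Filter F ->
  f y @[y --> F] --> f x -> F --> (x : initial_topology f).
Proof.
move=> FF cvf A [_ [[B Bo <-] Bx sBA]].
by apply: filterS sBA _; apply: cvf; exact: open_nbhs_nbhs.
Qed.

Section Polyhedral.
Variables (R : realType) (M N : vectType R) (p : pairing M N).

Lemma cone_generators (s : set N) : polyhedral_cone s ->
  exists (k : nat) (g : 'I_k -> N), (forall i, s (g i)) /\
    forall v, s v <->
      exists2 c : 'I_k -> R, forall i, 0 <= c i & v = \sum_i c i *: g i.
Proof.
move=> [k [g sE]]; exists k, g; split=> [i|v]; rewrite sE; last first.
  by split=> -[c c0 cv]; exists c.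
exists (fun j => (j == i)%:R); first by move=> j; rewrite ler0n.
rewrite (bigD1 i)//= eqxx scale1r big1 ?addr0// => j /negbTE ->.
by rewrite scale0r.
Qed.

Lemma cone_add (s : set N) v w (e : R) : polyhedral_cone s ->
  s v -> s w -> 0 <= e -> s (v + e *: w).
Proof.
move=> /cone_generators[k [g [_ sE]]] /sE[c c0 ->] /sE[d d0 ->] e0; apply/sE.
exists (fun i => c i + e * d i) => [i|]; first by rewrite addr_ge0 ?mulr_ge0.
rewrite scaler_sumr -big_split; apply: eq_bigr => i _.
by rewrite scalerDl scalerA.
Qed.

Lemma dual_dual (p_perfect : perfect p) (s : set N) v : polyhedral_cone s ->
  (forall u, dual_cone p s u -> 0 <= p u v) -> s v.
Proof.
move=> /cone_generators[k [g [sg sE]]] sv; apply/sE.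
apply: (farkas p_perfect) => u ug; apply: sv => w /sE[c c0 ->].
rewrite linear_sumr sumr_ge0// => i _.
by rewrite pairingZr mulr_ge0.
Qed.

Lemma dual_cone0 (s : set N) : dual_cone p s 0.
Proof. by move=> v _; rewrite linear0l. Qed.

Lemma face_sub (s t : set N) : face p t s -> t `<=` s.
Proof. by move=> [u _ ->] v []. Qed.

Lemma sub_dual_cone (s t : set N) : t `<=` s -> dual_cone p s `<=` dual_cone p t.
Proof. by move=> ts u us v /ts; exact: us. Qed.

(** The dual of the face cut out by r is the dual of s enlarged by the line of r.
The bound K exists because s has finitely many generators: adding a multiple of
r only has to repair the generators on which r is positive, as the others lie
in t. *)
Lemma dual_cone_face (s t : set N) : polyhedral_cone s -> face p t s ->
  exists2 r : M, annihilator p t r &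
    forall u, dual_cone p t u ->
      exists K : R, forall K', K <= K' -> dual_cone p s (u + K' *: r).
Proof.
move=> /cone_generators[k [g [sg sE]]] [r rs ->]; exists r => [v []//|u ut].
(* Generators with p r (g i) = 0 contribute 0 to this sum, as x / 0 = 0. *)
exists (\sum_i `|p u (g i)| / p r (g i)) => K leK v /sE[c c0 ->].
rewrite linear_sumr sumr_ge0// => i _; rewrite pairingZr mulr_ge0//.
rewrite linearDl pairingZl.
have := rs _ (sg i); rewrite le_eqVlt => /predU1P[r0|r0].
  by rewrite -r0 mulr0 addr0 ut.
rewrite -lerBlDl sub0r (le_trans (ler_norm _))// normrN -ler_pdivrMr//.
apply: le_trans leK; rewrite (bigD1 i)//= lerDl sumr_ge0// => j _.
by rewrite divr_ge0// rs.
Qed.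

(** A face of s that contains an interior point is s itself. *)
Lemma annihilator_relint (s : set N) u v : relint p s v -> dual_cone p s u ->
  `[< annihilator p s u >] = (p u v == 0).
Proof.
move=> [sv vmin] us; apply/asboolP/eqP => [|uv]; first exact.
suff FE : [set v | s v /\ p u v = 0] = s by move=> w; rewrite -{1}FE => -[].
by apply: contrapT => /vmin; apply; [exists u|split].
Qed.

(** The sum v0 of the generators lies in no proper face: a u in the dual that
kills v0 kills every generator. *)
Lemma relint_shift (s : set N) : polyhedral_cone s ->
  exists2 v0, s v0 & forall v e, s v -> 0 < e -> relint p s (v + e *: v0).
Proof.
move=> sP; have [k [g [sg sE]]] := cone_generators sP.
have sv0 : s (\sum_i g i).
  by apply/sE; exists (fun=> 1) => //; apply: eq_bigr => i _; rewrite scale1r.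
exists (\sum_i g i) => // v e sv e0; split; first exact: cone_add (ltW e0).
move=> _ [u us ->] Fs [_ uve]; apply: Fs; apply/seteqP; split=> [w []//|w sw].
split=> //; move: uve => /eqP; rewrite linearDr pairingZr.
rewrite paddr_eq0 ?mulr_ge0 ?(ltW e0) ?us// mulf_eq0 (gt_eqF e0) /= => /andP[_].
rewrite linear_sumr psumr_eq0 => [/allP u0|i _]; last exact: us.
move: sw => /sE[c _ ->]; rewrite linear_sumr big1// => i _.
by rewrite pairingZr (eqP (u0 i _)) ?mulr0 ?mem_index_enum.
Qed.

Lemma pairing_continuousr u : continuous (fun v : euclidean N => p u v).
Proof.
pose f (x : 'rV[R]_(\dim {:N})) := \sum_i x 0 i * p u (vbasis {:N})`_i.
have -> : (fun v : euclidean N => p u v) = f \o @coordinates R N.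
  apply/funext => v; rewrite /f /= [in LHS](coord_vbasis (memvf (v : N))).
  by rewrite linear_sumr; apply: eq_bigr => i _; rewrite pairingZr /= mxE.
move=> v; apply: continuous_comp; first exact: initial_continuous.
have cf i :
    continuous (fun x : 'rV[R]_(\dim {:N}) => x 0 i * p u (vbasis {:N})`_i).
  by move=> x; exact: (cvgM (@coord_continuous R 1 _ 0 i x) (cvg_cst _)).
by apply: (@continuous_big R) => [|i _]; [exact: add_continuous|exact: cf].
Qed.

Lemma polyhedral_closed (p_perfect : perfect p) (s : set (euclidean N)) :
  polyhedral_cone (s : set N) -> closed s.
Proof.
move=> sP.
have -> : s = \bigcap_(u in dual_cone p s) [set v : euclidean N | 0 <= p u v].
  apply/seteqP; split=> [v sv u /= us|v vs]; first exact: us.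
  exact: dual_dual.
apply: closed_bigI => u _.
apply: (@closed_comp _ _ (fun v : euclidean N => p u v)) (@closed_ge _ 0).
move=> v _; exact: pairing_continuousr.
Qed.

Lemma closure_relint (p_perfect : perfect p) (s : set (euclidean N)) :
  polyhedral_cone (s : set N) -> closure (relint p s : set (euclidean N)) = s.
Proof.
move=> sP; apply/seteqP; split=> [v|v sv].
  move=> cv; apply: (polyhedral_closed p_perfect sP); move: cv.
  by apply: closureS => w [].
have [v0 sv0 sE] := relint_shift sP.
have cv : (v + e *: v0 : euclidean N) @[e --> 0^'+] --> (v : euclidean N).
  apply: cvg_initial; apply: cvg_at_right_filter.
  have -> : (fun e => @coordinates R N (v + e *: v0)) =
      (fun e => coordinates v + e *: coordinates v0).
    apply/funext => e; apply/rowP => i.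
    by rewrite !mxE linearD linearZ.
  rewrite -[X in _ --> X]addr0 -[X in _ + X](scale0r (coordinates v0)).
  by apply: cvgD; [exact: cvg_cst|exact: scalel_continuous].
have rc := @closed_closure _ (relint p s : set (euclidean N)).
apply: (@closed_cvg _ _ _ _ _ _ rc _ _ cv).
near=> e; apply: subset_closure; apply: sE => //.
Unshelve. all: by end_near. Qed.

End Polyhedral.

(** * Monoid homomorphisms on a cone *)

Lemma set_type_exists T (C : set T) u : C u -> exists a : C, set_val a = u.
Proof. by move=> Cu; exists (exist (fun u => u \in C) u (mem_set Cu)). Qed.

Section Homc.
Variables (R : realType) (M N : vectType R) (p : pairing M N).
Implicit Types C : set (euclidean M).

Lemma homc_fun_inj C (phi psi : homc p C) :
  (forall a, homc_fun phi a = homc_fun psi a) -> phi = psi.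
Proof. by move=> e; apply: val_inj; apply/funext. Qed.

Lemma homcD C (phi : homc p C) (a a' c : C) :
  set_val c = (set_val a : M) + set_val a' ->
  homc_fun phi c = homc_fun phi a * homc_fun phi a'.
Proof. by have [_ _ + _] := set_mem (valP phi); exact. Qed.

Lemma homc0 C (phi : homc p C) (a : C) : set_val a = 0 :> M -> homc_fun phi a = 1.
Proof. by have [_ + _ _] := set_mem (valP phi); exact. Qed.

Lemma homc_ge0 C (phi : homc p C) (a : C) : 0 <= homc_fun phi a.
Proof. by have [+ _ _ _] := set_mem (valP phi); exact. Qed.

Lemma homc_unit_gt0 C (phi : homc p C) (a a' : C) :
  set_val a' = - set_val a :> M -> C 0 -> 0 < homc_fun phi a.
Proof.
move=> a'E C0; rewrite lt_neqAle homc_ge0 andbT; apply/eqP => /esym phia0.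
have [z zE] := set_type_exists C0.
have /eqP := homc0 phi zE.
rewrite (@homcD _ phi a a') ?phia0 ?mul0r; last by rewrite zE a'E addrN.
by rewrite eq_sym oner_eq0.
Qed.

Lemma homc_fun_continuous C (a : C) :
  continuous (fun phi : homc p C => homc_fun phi a).
Proof.
move=> phi.
apply: (@continuous_comp (homc p C) {ptws C -> R} R (@homc_fun _ _ _ p C)
  (fun f => f a)).
  exact: initial_continuous.
exact: (@proj_continuous C (fun=> R) a).
Qed.

Lemma cvg_homc C T (F : set_system T) {FF : Filter F} (f : T -> homc p C)
    (phi : homc p C) :
  (forall a, homc_fun (f t) a @[t --> F] --> homc_fun phi a) ->
  f t @[t --> F] --> phi.
Proof.
move=> cvf; apply: (@cvg_initial _ _
  (set_val : set_type (@is_homc _ _ _ p C) -> {ptws C -> R})).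
by apply/pointwise_cvgP.
Qed.

Lemma homc_one_subproof C : is_homc p (fun _ : C => 1 : R).
Proof.
split=> // [a a' c _|F _]; first by rewrite mulr1.
by apply: continuous_subspaceT; exact: cst_continuous.
Qed.

Definition homc_one C : homc p C :=
  exist (fun f => f \in @is_homc _ _ _ p C) _ (mem_set (@homc_one_subproof C)).

End Homc.

(** * Characters as rational functions on the toric variety *)

Section Character.
Variables (R : realType) (M N : vectType R) (p : pairing M N) (Sigma : fan p).
Implicit Types (u : M) (A : set R) (x y : charts Sigma).

(** The rational function chi^u is defined at x and takes a value in A there. The
value phi c / phi b depends on u only: if c = u + b and c' = u + b', then
phi c * phi b' = phi c' * phi b. *)
Definition character_in u A x :=
  exists b c : dual_cone p (set_val (projT1 x)),
    [/\ 0 < homc_fun (projT2 x) b, set_val c = u + set_val b :> M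
      & A (homc_fun (projT2 x) c / homc_fun (projT2 x) b)].

(** Let t be a face of s. A fraction on V_t becomes one on V_s when both its
numerator and its denominator are translated by a large multiple of the r that
cuts out t; as r is invertible on V_t, the value does not change. *)
Lemma character_in_glued u A x y :
  glued x y -> character_in u A x <-> character_in u A y.
Proof.
move=> [ts xyE].
have sub (a : dual_cone p (set_val (projT1 y))) :
    exists a' : dual_cone p (set_val (projT1 x)), set_val a' = set_val a :> M.
  by apply: set_type_exists; exact: (sub_dual_cone (face_sub ts)) (set_mem (valP a)).
split=> -[b [c [b0 cE Abc]]]; last first.
  have [[b' bE] [c' c'E]] := (sub b, sub c).
  by exists b', c'; rewrite -(xyE _ b) -?(xyE _ c)// c'E bE.
have sP := fan_polyhedral (set_mem (valP (projT1 y))).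
have [r rt rE] := dual_cone_face sP ts.
have [Kb Kbs] := rE (set_val b) (set_mem (valP b)).
have [Kc Kcs] := rE (set_val c) (set_mem (valP c)).
pose K := Num.max Kb Kc.
have [|b' b'E] := set_type_exists (Kbs K _); first by rewrite le_max lexx.
have [|c' c'E] := set_type_exists (Kcs K _); first by rewrite le_max lexx orbT.
have [[b1 b1E] [c1 c1E]] := (sub b', sub c').
(* d and d' are K *: r and its opposite, both in the dual of t. *)
have [d dE] : exists d : dual_cone p (set_val (projT1 x)),
    set_val d = K *: r :> M.
  by apply: set_type_exists => v tv; rewrite pairingZl rt// mulr0.
have [d' d'E] : exists d' : dual_cone p (set_val (projT1 x)),
    set_val d' = - set_val d :> M.
  apply: set_type_exists => v tv.
  by rewrite dE linearNl pairingZl rt// mulr0 oppr0.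
have d0 : 0 < homc_fun (projT2 x) d.
  exact: homc_unit_gt0 d'E (@dual_cone0 _ _ _ p _).
have bE : homc_fun (projT2 x) b1 =
    homc_fun (projT2 x) b * homc_fun (projT2 x) d.
  by apply: homcD; rewrite b1E b'E dE.
have cE1 : homc_fun (projT2 x) c1 =
    homc_fun (projT2 x) c * homc_fun (projT2 x) d.
  by apply: homcD; rewrite c1E c'E dE.
exists b', c'; rewrite (xyE b1)// (xyE c1)// bE cE1; split.
- exact: mulr_gt0.
- by rewrite c'E b'E cE addrA.
- by rewrite -mulf_div divff ?gt_eqF// mulr1.
Qed.

Lemma character_in_glue u A x y :
  Defs.glue x y -> character_in u A x <-> character_in u A y.
Proof.
move=> /asboolP.
elim=> {x y}[x y /character_in_glued //|//|x y _ xy|x y z _ xy _ yz].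
  exact: iff_sym.
exact: iff_trans yz.
Qed.

Lemma open_character_in u A :
  open A -> open (character_in u A : set (charts Sigma)).
Proof.
move=> Ao; apply/sigT_openP => s; rewrite openE => phi [b [c [b0 cE Abc]]].
have cvb := @homc_fun_continuous _ _ _ p _ b phi.
have cvc := @homc_fun_continuous _ _ _ p _ c phi.
near=> psi; exists b, c; split=> //=; near: psi.
  exact: cvgr_gt cvb _ b0.
have cvbc : homc_fun psi c / homc_fun psi b @[psi --> phi] -->
    homc_fun phi c / homc_fun phi b.
  exact: (cvgM cvc (cvgV (lt0r_neq0 b0) cvb)).
by apply: cvbc; exact: open_nbhs_nbhs.
Unshelve. all: by end_near. Qed.

Lemma character_in_repr u A x :
  character_in u A (repr (\pi_(toric_variety Sigma) x)) <->
  character_in u A x.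
Proof.
by apply: character_in_glue; apply/(@eqmodP _ (glue_equiv Sigma)); rewrite reprK.
Qed.

(** This replaces the openness of the charts: a limit in the glued space controls
every character that is defined at the limit point. *)
Lemma cvg_character_in T (F : set_system T) {FF : Filter F}
    (f : T -> toric_variety Sigma) x u A :
  open A ->
  f t @[t --> F] --> (\pi_(toric_variety Sigma) x : toric_variety Sigma) ->
  character_in u A x -> \forall t \near F, character_in u A (repr (f t)).
Proof.
move=> Ao cvf xA.
apply: (cvf [set z | character_in u A (repr z)]); apply: open_nbhs_nbhs; split.
  rewrite /open /= /quotient_open.
  rewrite (_ : _ @^-1` _ = character_in u A).
    exact: open_character_in.
  by apply/funext => z; apply/propext; exact: character_in_repr.
exact/character_in_repr.
Qed.

End Character.

(** * Relative interiors of the cones of a fan *)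

Lemma finite_minimal T (S : set (set T)) (s0 : set T) : finite_set S -> S s0 ->
  exists2 m, S m & forall t, S t -> t `<=` m -> t = m.
Proof.
move=> /finite_seqP[l ->]; case: l => // a l _.
elim: l a => [|b l IHl] a.
  by exists a; rewrite /= ?mem_head// => t; rewrite inE => /eqP.
have [m mbl mmin] := IHl b.
have [am|am] := pselect (a `<=` m); last first.
  exists m => [|t]; first by rewrite /= in_cons; apply/orP; right.
  by rewrite /= in_cons => /predU1P[-> //|]; exact: mmin.
exists a => [|t]; first exact: mem_head.
rewrite /= in_cons => /predU1P[-> //|tbl ta].
have tm := mmin _ tbl (subset_trans ta am).
by apply/seteqP; split=> //; rewrite tm.
Qed.

Section Fan.
Variables (R : realType) (M N : vectType R) (p : pairing M N) (Sigma : fan p).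
Implicit Types (s t : cones Sigma) (v : N).

Lemma cone_mem s : cones Sigma (set_val s).
Proof. exact: (set_mem (valP s)). Qed.

Lemma cone_polyhedral s : polyhedral_cone (set_val s).
Proof. exact: fan_polyhedral (cone_mem s). Qed.

(** A smallest cone of the fan that contains v has v in its relative interior,
since its faces are cones of the fan. *)
Lemma relint_exists v : (\bigcup_(s in cones Sigma) s) v ->
  exists s, relint p (set_val s) v.
Proof.
move=> [s0 Ss0 s0v].
have fin : finite_set [set s | cones Sigma s /\ s v].
  by apply: sub_finite_set (fan_finite Sigma) => s [].
have [t [St tv] tmin] := finite_minimal fin (conj Ss0 s0v).
have [t' tE] := set_type_exists St.
exists t'; rewrite tE; split=> // F Ft FneqT Fv; apply: FneqT.
by apply: tmin (face_sub Ft); split=> //; exact: fan_face Ft.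
Qed.

Lemma relint_face s t v : relint p (set_val s) v -> (set_val t : set N) v ->
  face p (set_val s) (set_val t).
Proof.
move=> [sv vmin] tv; have [fs ft] := fan_meet (cone_mem s) (cone_mem t).
suff <- : set_val s `&` set_val t = set_val s by [].
by apply: contrapT => /(vmin _ fs); apply.
Qed.

Lemma relint_unique s t v :
  relint p (set_val s) v -> relint p (set_val t) v -> s = t.
Proof.
move=> rs rt; apply: val_inj; apply/seteqP.
by split; apply: face_sub; [exact: relint_face rs rt.1|exact: relint_face rt rs.1].
Qed.

End Fan.

(** * One-parameter limits of a point of the dense orbit *)

Section Limits.
Variables (R : realType) (M N : vectType R) (p : pairing M N) (Sigma : fan p).
Implicit Types (s t : cones Sigma) (u : M) (v w : N).

(** The point gamma_w of the torus, seen in the chart of s; it is the same point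
of the toric variety for all s. *)
Definition dense_point w s : toric_variety Sigma :=
  of_chart (homc_act w (homc_one p (dual_cone p (set_val s))) : chart s).

Definition orbit_point w s : toric_variety Sigma :=
  of_chart (homc_act w (distinguished_point s)).

Lemma of_chart_eq s t (phi : chart s) (psi : chart t) :
  of_chart phi = of_chart psi <->
  Defs.glue (existT _ s phi) (existT _ t psi).
Proof. by split=> /(@eqmodP _ (glue_equiv Sigma)). Qed.

Lemma of_chart_face s t (phi : chart s) (psi : chart t) :
  face p (set_val s) (set_val t) ->
  (forall a b, set_val a = set_val b :> M -> homc_fun psi b = homc_fun phi a) ->
  of_chart phi = of_chart psi.
Proof. by move=> st e; apply/of_chart_eq/asboolP; apply: rst_step. Qed.

Lemma homc_ptE s (a : dual_cone p (set_val s)) :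
  homc_fun (distinguished_point s) a =
  `[< annihilator p (set_val s) (set_val a) >]%:R.
Proof. by []. Qed.

Lemma homc_actE (C : set (euclidean M)) v (phi : homc p C) a :
  homc_fun (homc_act v phi) a = gamma p v (set_val a) * homc_fun phi a.
Proof. by []. Qed.

(** Each face of the minimal cone L is a cone of the fan, hence contains L; so the
elements of the dual of L annihilate L, and x_L is the constant 1. *)
Lemma dense_orbitP (y : toric_variety Sigma) : dense_orbit y ->
  exists w, forall s, y = dense_point w s.
Proof.
move=> [L Lmin [w _ <-]]; exists w => s.
have [_ Ls] := fan_meet (cone_mem L) (cone_mem s).
rewrite (setIidl (Lmin _ (cone_mem s))) in Ls.
rewrite of_chart_act; apply: of_chart_face => // a b ab.
rewrite !homc_actE homc_ptE -ab mulr1 asboolT ?mulr1// => v Lv.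
pose F := [set v | set_val L v /\ p (set_val a) v = 0].
have FL : face p F (set_val L).
  by exists (set_val a) => //; exact: (set_mem (valP a)).
by have [] := Lmin _ (fan_face (cone_mem L) FL) v Lv.
Qed.

Lemma torus_act_dense v w s :
  torus_act v (dense_point w s) = dense_point (v + w) s.
Proof.
rewrite of_chart_act; congr (of_chart _); apply: homc_fun_inj => a.
by rewrite !homc_actE mulrA /gamma linearDr opprD expRD.
Qed.

(** The denominators allowed at w . x_s are the b in the annihilator of s, which
lie in the dual of s together with their opposites. *)
Lemma character_in_orbit_point w s u :
  character_in u setT
    (existT _ s (homc_act w (distinguished_point s)) : charts Sigma) <->
  dual_cone p (set_val s) u.
Proof.
split=> [[b [c [b0 cE _]]] v sv|us].
  have /asboolP bs : `[< annihilator p (set_val s) (set_val b) >].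
    move: b0; rewrite homc_actE homc_ptE /=.
    by case: asboolP => //; rewrite mulr0 ltxx.
  have : 0 <= p (set_val c) v by apply: (set_mem (valP c)).
  by rewrite cE linearDl bs// addr0.
have [b bE] := set_type_exists (@dual_cone0 _ _ _ p (set_val s)).
have [c cE] := set_type_exists us.
exists b, c; split=> //; last by rewrite cE bE addr0.
by rewrite /= homc0.
Qed.

Lemma orbit_point_inj (p_perfect : perfect p) w w' s t :
  orbit_point w s = orbit_point w' t -> s = t.
Proof.
move=> /of_chart_eq st.
have dE u : dual_cone p (set_val s) u <-> dual_cone p (set_val t) u.
  rewrite -(character_in_orbit_point w) -(character_in_orbit_point w').
  exact: character_in_glue.
apply: val_inj; apply/seteqP.
by split=> v sv; apply: (dual_dual p_perfect (cone_polyhedral _)) => u /dE; exact.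
Qed.

Lemma gamma_cvg v w u : 0 <= p u v ->
  gamma p (r *: v + w) u @[r --> +oo] --> gamma p w u * (p u v == 0)%:R.
Proof.
move=> uv; under eq_fun do
  rewrite /gamma linearDr pairingZr opprD addrC expRD -/(gamma p w u).
apply: cvgM; first exact: cvg_cst.
have [->|uv0] := eqVneq.
  by under eq_fun do rewrite mulr0 oppr0 expR0; exact: cvg_cst.
apply: (cvg_comp (fun r : R => r * p u v) (fun x => expR (- x))).
  2: exact: cvgr_expR.
by apply: gt0_cvgMly; [rewrite lt_neqAle eq_sym uv0|exact: cvg_id].
Qed.

Lemma of_chart_continuous s : continuous (@of_chart _ _ _ _ Sigma s).
Proof.
move=> phi.
apply: (@continuous_comp (chart s) (charts Sigma) (toric_variety Sigma)
  (existT _ s) (\pi_(toric_variety Sigma))).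
  exact: (@existT_continuous _ (fun s => chart s : topologicalType)).
exact: pi_continuous.
Qed.

Lemma tends_to_orbit_point w s v : relint p (set_val s) v ->
  tends_to (dense_point w s) v (orbit_point w s).
Proof.
move=> vs; rewrite /tends_to; under eq_fun do rewrite torus_act_dense.
have cv :
    (homc_act (r *: v + w) (homc_one p (dual_cone p (set_val s))) : chart s)
    @[r --> +oo] --> (homc_act w (distinguished_point s) : chart s).
  apply: cvg_homc => a; under eq_fun do rewrite homc_actE mulr1.
  rewrite homc_actE homc_ptE.
  have sa : dual_cone p (set_val s) (set_val a) := set_mem (valP a).
  by rewrite (annihilator_relint vs sa); exact: gamma_cvg (sa _ vs.1).
exact: (cvg_comp _ _ cv (@of_chart_continuous s _)).
Qed.

(** If u . v < 0, the left-hand side grows at least linearly in r. *)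
Lemma gamma_cvg_ge0 v w u (l : R) :
  gamma p (r *: v + w) u @[r --> +oo] --> l -> 0 <= p u v.
Proof.
move=> cvl; rewrite leNgt; apply/negP; rewrite -oppr_gt0; set q := - p u v => q0.
have g0 : 0 < gamma p w u by exact: expR_gt0.
suff : \forall r \near pinfty_nbhs R, False by move=> /filter_ex[].
near=> r.
have : gamma p (r *: v + w) u < l + 1.
  by near: r; apply: (cvgr_lt _ cvl); rewrite ltrDl.
have rl : (l + 1) / (gamma p w u * q) <= r.
  by near: r; apply: nbhs_pinfty_ge; exact: num_real.
apply/negP; rewrite -leNgt; rewrite ler_pdivrMr ?mulr_gt0// in rl.
have -> : gamma p (r *: v + w) u = gamma p w u * expR (r * q).
  by rewrite /gamma linearDr pairingZr opprD addrC expRD mulrN.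
rewrite (le_trans rl)// mulrCA ler_pM2l// (le_trans _ (expR_ge1Dx _))//.
by rewrite lerDr.
Unshelve. all: by end_near. Qed.

Lemma character_in_dense w s u A :
  character_in u A (existT _ s
    (homc_act w (homc_one p (dual_cone p (set_val s)))) : charts Sigma) ->
  A (gamma p w u).
Proof.
move=> [b [c [_ cE]]]; rewrite /= !homc_actE /= !mulr1 cE.
by rewrite /gamma linearDl opprD expRD mulfK// gt_eqF ?expR_gt0.
Qed.

(** The limit psi in V_t has the value of w . x_s at each u in the dual of t; so
psi is w . x_s, restricted to that dual. *)
Lemma tends_to_dense (p_perfect : perfect p) y w v z :
  (forall s, y = dense_point w s) -> tends_to y v z ->
  exists2 s, relint p (set_val s) v & z = orbit_point w s.
Proof.
move=> yE; rewrite -[z]reprK; case: (repr z) => t psi yz.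
have cvt (a : dual_cone p (set_val t)) :
    gamma p (r *: v + w) (set_val a) @[r --> +oo] --> homc_fun psi a.
  move=> A; rewrite nbhsE => -[B [Bo Ba] BA].
  have [b bE] := set_type_exists (@dual_cone0 _ _ _ p (set_val t)).
  have /(cvg_character_in Bo yz) :
      character_in (set_val a) B (existT _ t psi : charts Sigma).
    exists b, a; rewrite /= homc0// divr1; split=> //.
    by rewrite bE addr0.
  apply: filterS => r; rewrite (yE t) torus_act_dense.
  by move=> /character_in_repr/character_in_dense/BA.
have tv : (set_val t : set N) v.
  apply: (dual_dual p_perfect (cone_polyhedral t)) => u ut.
  by have [a <-] := set_type_exists ut; exact: gamma_cvg_ge0 (cvt a).
have [s sv] : exists s, relint p (set_val s) v.
  by apply: relint_exists; exists (set_val t) => //; exact: cone_mem.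
exists s => //; apply/esym; have st := relint_face sv tv.
apply: (of_chart_face st) => a b ab; rewrite homc_actE homc_ptE ab.
have bt : dual_cone p (set_val t) (set_val b) := set_mem (valP b).
have bs := sub_dual_cone (face_sub st) bt.
rewrite (annihilator_relint sv bs).
exact: (norm_cvg_unique (cvt b) (gamma_cvg (bt _ tv))).
Qed.

End Limits.

Theorem corollary4p4 (R : realType) (M N : vectType R) (p : pairing M N)
    (p_perfect : perfect p) (Sigma : fan p) (Sigma0 : cones Sigma !=set0)
    (y : toric_variety Sigma) (y_dense : dense_orbit y) :
  [/\ has_limit y = \bigcup_(s in cones Sigma) s,
      [set [set w | has_limit y w /\ limit y v = limit y w] | v in has_limit y]
        = [set relint p s | s in cones Sigma]
    & forall s : cones Sigma,
        set_val s = closure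
          ([set v | has_limit y v /\ torus_orbit s (limit y v)] : set (euclidean N))].
Proof.
have [w yE] := dense_orbitP y_dense.
have limP v z : tends_to y v z <->
    exists2 s, relint p (set_val s) v & z = orbit_point w s.
  split; first exact: tends_to_dense.
  by move=> [s vs ->]; rewrite (yE s); exact: tends_to_orbit_point.
have limE v (s : cones Sigma) : relint p (set_val s) v ->
    has_limit y v /\ limit y v = orbit_point w s.
  move=> vs; have yv : tends_to y v (orbit_point w s) by apply/limP; exists s.
  split; first by exists (orbit_point w s).
  apply: xget_unique => // z /limP[t vt ->].
  by rewrite (relint_unique vs vt).
have has_limitP v : has_limit y v -> exists s : cones Sigma, relint p (set_val s) v.
  by move=> [z /limP[s vs _]]; exists s.
have classE v (s : cones Sigma) : relint p (set_val s) v ->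
    [set v' | has_limit y v' /\ limit y v = limit y v'] = relint p (set_val s).
  move=> vs; have [_ yv] := limE _ _ vs.
  apply/seteqP; split=> [v' [/has_limitP[t v't]]|v' v's] /=.
    by rewrite yv (limE _ _ v't).2 => /(orbit_point_inj p_perfect) ->.
  by have [yv' v'E] := limE _ _ v's; rewrite yv v'E.
split.
- apply/seteqP; split=> v; first move=> /has_limitP[s [sv _]].
    by exists (set_val s) => //; exact: cone_mem.
  by move=> /(relint_exists)[s /limE[]].
- apply/seteqP; split=> X [].
    move=> v /has_limitP[s vs] <-; rewrite (classE _ _ vs).
    by exists (set_val s) => //; exact: cone_mem.
  move=> s0 Ss0 <-; have [s <-] := set_type_exists Ss0.
  have [v0 sv0 vs] := @relint_shift _ _ _ p _ (cone_polyhedral s).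
  have {}vs := vs _ _ sv0 ltr01.
  by exists (v0 + 1 *: v0); [exact: (limE _ _ vs).1|exact: classE].
- move=> s; rewrite -[LHS](closure_relint p_perfect (cone_polyhedral s)).
  apply: congr1; apply/seteqP; split=> v /=.
    move=> /limE[yv ->]; split=> //; exists w => //; exact: of_chart_act.
  move=> [/has_limitP[t vt]]; rewrite (limE _ _ vt).2 => -[w' _].
  by rewrite of_chart_act => st; rewrite (orbit_point_inj p_perfect st).
Qed.
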